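(* Let $\mathcal{R}$ be a unital ring and let $\mathcal{M}$ be a free left $\mathcal{R}$-module with basis $\mathcal{Y}$ (with discrete topology). Let $P$ be a well-founded partial order on $\mathcal{Y}$. Let $V$ be a monoid (under composition) of $\mathcal{R}$-module homomorphisms $\mathcal{M}\to\mathcal{M}$ that map $\mathcal{Y}$ into $\mathcal{Y}$ and are strictly monotone with respect to $P$, i.e. $\nu<\mu$ in $P$ implies $v(\nu)<v(\mu)$ in $P$ for all $\mu,\nu\in\mathcal{Y}$, $v\in V$. Let $S\subseteq\mathcal{Y}\times\mathcal{M}$ be such that $a\in\mathrm{DSM}(\mu,P)$ for every $(\mu,a)\in S$. Let $T_1(S)=\{t_{v,s}: v\in V,\ s\in S\}$ where $$t_{v,(\mu,a)}(b)=b-f_{v(\mu)}(b)\cdot v(\mu-a)\qquad\text{for all }b\in\mathcal{M},$$ $f_\lambda:\mathcal{M}\to\mathcal{R}$ being the coefficient-of-$\lambda$ homomorphism for $\lambda\in\mathcal{Y}$. Then the following conditions are equivalent: (a) Every ambiguity of $T_1(S)$ is resolvable. (a') Every ambiguity of $T_1(S)$ is resolvable relative to $P$. (a'') Every $V$-critical ambiguity of $T_1(S)$ is resolvable relative to $P$. (a''') For every $V$-critical ambiguity $(t_1,\mu,t_2)$ of $T_1(S)$ there exists some $t\in T(S)$ such that $t(t_1(\mu)-t_2(\mu))=0$. (b) Every element of $\mathcal{M}$ is persistently and uniquely reducible. (c) Every element of $\mathcal{M}$ has a unique normal form, i.e. $\mathcal{M}=\mathrm{Irr}(S)\oplus\mathcal{I}(S)$.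 (d) The set $\{\mu-a\}_{(\mu,a)\in S}$ is a $P$-monic $V$-Gröbner-basis of $\mathcal{I}(S)$.
   Context: $\mathrm{Span}$ denotes the $\mathcal{R}$-submodule generated. ''$\nu<\mu$ in $P$'' is the strict relation; well-founded means there is no infinite strictly descending sequence. $\mathrm{DSM}(\mu,P)=\mathrm{Span}(\{\nu\in\mathcal{Y}:\nu<\mu\text{ in }P\})$. $T(S)$ is the set of all finite compositions of elements of $T_1(S)$, including the identity. $t$ acts trivially on $a$ if $t(a)=a$. $\mathrm{Irr}(S)=\{a\in\mathcal{M}:t(a)=a\ \forall t\in T(S)\}$. $\mathcal{I}(S)=\sum_{t\in T(S)}\{a-t(a):a\in\mathcal{M}\}$. A normal form of $b$ is an $a\in\mathrm{Irr}(S)$ with $a-b\in\mathcal{I}(S)$. An $a\in\mathcal{M}$ is persistently reducible if for every $t_1\in T(S)$ there is $t_2\in T(S)$ with $t_2(t_1(a))\in\mathrm{Irr}(S)$; it is uniquely reducible if whenever $t_1,t_2\in T(S)$ satisfy $t_1(a),t_2(a)\in\mathrm{Irr}(S)$ one has $t_1(a)=t_2(a)$. $\mathrm{DIS}(\mu,P,S)=\mathrm{Span}(\{\nu-t(\nu):\nu\in\mathcal{Y},\nu<\mu\text{ in }P,t\in T_1(S)\})$. An ambiguity of $T_1(S)$ is a triplet $(t_1,\mu,t_2)$ with $t_1,t_2\in T_1(S)$ both acting nontrivially on $\mu\in\mathcal{Y}$; $(t_1,\mu,t_2)$ and $(t_2,\mu,t_1)$ are considered equivalent. It is resolvable if there are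 $t_3,t_4\in T(S)$ with $t_3(t_1(\mu))=t_4(t_2(\mu))$, and resolvable relative to $P$ if $t_1(\mu)-t_2(\mu)\in\mathrm{DIS}(\mu,P,S)$. $V$-critical: Let $\mathcal{R}^*\mathcal{Y}=\{r\cdot\mu:r\in\mathcal{R},\mu\in\mathcal{Y}\}$. An ambiguity $(t,\mu,u)$ is a $V$-shadow of the ambiguity $(t',\mu',u')$ if there is $v\in V$ with $\mu=v(\mu')$, $t(\mu)=v(t'(\mu'))$, $u(\mu)=v(u'(\mu'))$; it is a proper $V$-shadow if moreover $(t',\mu',u')$ is not a $V$-shadow of $(t,\mu,u)$. An ambiguity is $V$-shadow-minimal if it is not a proper $V$-shadow of any ambiguity, and $V$-shadow-critical if it is not a proper $V$-shadow of any $V$-shadow-minimal ambiguity. A map $w:\mathcal{M}\times\mathcal{M}\to\mathcal{M}$ additive in each argument is biadvanceable if for all $b_1,b_2\in\mathcal{R}^*\mathcal{Y}$: for every $t_1\in T_1(S)$ there is $t\in T(S)$ with $t(w(b_1,b_2))=w(t_1(b_1),b_2)$, and for every $t_2\in T(S)$ there is $t\in T(S)$ with $t(w(b_1,b_2))=w(b_1,t_2(b_2))$. It is $(V,V)$-biadvanceable if moreover $w(\cdot,\rho)\in V$ and $w(\rho,\cdot)\in V$ for all $\rho\in\mathcal{Y}$. An ambiguity $(t,\mu,u)$ is a $(V,V)$-montage ambiguity if there are $(\lambda,t'),(\nu,u')\in\mathcal{Y}\times T_1(S)$ and a $(V,V)$-biadvanceable $w$ such that $\mu=w(\lambda,\nu)$,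 $t(\mu)=w(t'(\lambda),\nu)$, $u(\mu)=w(\lambda,u'(\nu))$. An ambiguity is $V$-critical if it is $V$-shadow-critical and is not a $(V,V)$-montage ambiguity. Gröbner bases: $\mathrm{supp}(a)=\{\mu\in\mathcal{Y}:f_\mu(a)\neq0\}$; $\mathrm{LM}_P(a)$ is the set of $P$-maximal elements of $\mathrm{supp}(a)$; if it has exactly one element, that element is $\mathrm{lm}_P(a)$. $g\in\mathcal{M}$ is $P$-monic if there is $\mu\in\mathcal{Y}$ with $g-\mu\in\mathrm{DSM}(\mu,P)$; a set is $P$-monic if all its elements are. A $V$-ideal is a submodule $N\subseteq\mathcal{M}$ with $v(a)\in N$ for all $v\in V$, $a\in N$. A subset $G\subseteq\mathcal{M}$ is a $P$-monic $V$-Gröbner-basis of a $V$-ideal $N$ if $G$ is $P$-monic, $v(g)\in N$ for all $v\in V$, $g\in G$, and for every $a\in N$ and $\mu\in\mathrm{LM}_P(a)$ there exist $g\in G$ and $v\in V$ with $\mu=v(\mathrm{lm}_P(g))$. *)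

(* Defs.v *)
From mathcomp Require Import all_boot all_order all_algebra.
From mathcomp Require Import all_classical.

Set Implicit Arguments.
Unset Strict Implicit.
Unset Printing Implicit Defensive.

Import GRing.Theory.
Local Open Scope classical_set_scope.
Local Open Scope ring_scope.

Section FreeModule.
Variables (R : pzRingType) (M : lmodType R).

Definition is_submodule (N : set M) : Prop := GRing.submod_closed [in N].

Definition Span (A : set M) : set M := smallest is_submodule A.

Definition lin_indep (Y : set M) : Prop :=
  forall (s : seq M) (c : M -> R), uniq s -> (forall x, x \in s -> Y x) ->
    \sum_(x <- s) c x *: x = 0 -> forall x, x \in s -> c x = 0.

Definition is_basis (Y : set M) : Prop := lin_indep Y /\ Span Y = setT.

(* c is a finitely supported family of coefficients on Y representing a *)
Definition is_coords (Y : set M) (a : M) (c : M -> R) : Prop :=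
  exists s : seq M, [/\ uniq s, forall x, x \in s -> Y x,
    forall x, x \notin s -> c x = 0 & a = \sum_(x <- s) c x *: x].

(* f_lam(a); the default value 0 of the choice is never used when Y is a
   basis, since the representing family then exists and is unique. *)
Definition coef (Y : set M) (lam a : M) : R :=
  xget 0 [set r | exists2 c, is_coords Y a c & r = c lam].

Definition supp (Y : set M) (a : M) : set M :=
  [set mu | Y mu /\ coef Y mu a <> 0].

End FreeModule.

(* The order P is a relation on the ambient type of which only the restriction
   to Y is ever used. *)
Section Order.
Variables (T : Type) (Y : set T) (P : T -> T -> Prop).

Definition partial_order_on : Prop :=
  [/\ forall x, Y x -> P x x,
      forall x y, Y x -> Y y -> P x y -> P y x -> x = y &
      forall x y z, Y x -> Y y -> Y z -> P x y -> P y z -> P x z].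

Definition ltP (x y : T) : Prop := P x y /\ x <> y.

Definition well_founded_on : Prop :=
  forall u : nat -> T, (forall n, Y (u n)) -> ~ (forall n, ltP (u n.+1) (u n)).

End Order.

Definition DSM (R : pzRingType) (M : lmodType R) (Y : set M)
    (P : M -> M -> Prop) (mu : M) : set M :=
  Span [set nu | Y nu /\ ltP P nu mu].

Definition monotone_hom_monoid (R : pzRingType) (M : lmodType R) (Y : set M)
    (P : M -> M -> Prop) (V : set (M -> M)) : Prop :=
  [/\ V id,
      forall v w, V v -> V w -> V (v \o w),
      forall v, V v -> linear v,
      forall v, V v -> forall mu, Y mu -> Y (v mu) &
      forall v, V v -> forall mu nu, Y mu -> Y nu ->
        ltP P nu mu -> ltP P (v nu) (v mu)].

Section Reductions.
Variables (R : pzRingType) (M : lmodType R) (Y : set M) (P : M -> M -> Prop).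
Variables (V : set (M -> M)) (S : set (M * M)).

Definition simple_reduction (v : M -> M) (s : M * M) (b : M) : M :=
  b - coef Y (v s.1) b *: v (s.1 - s.2).

Definition T1 : set (M -> M) :=
  [set t | exists v s, [/\ V v, S s & t = simple_reduction v s]].

Inductive Tcomp : (M -> M) -> Prop :=
| Tcomp_id : Tcomp id
| Tcomp_cons t u : T1 t -> Tcomp u -> Tcomp (t \o u).

Definition Irr : set M := [set a | forall t, Tcomp t -> t a = a].

(* the sum over t in T(S) of the submodules {b - t(b) : b in M} *)
Definition IS : set M :=
  [set a | exists n (t : 'I_n -> M -> M) (b : 'I_n -> M),
    (forall i, Tcomp (t i)) /\ a = \sum_(i < n) (b i - t i (b i))].

Definition normal_form (b a : M) : Prop := Irr a /\ IS (a - b).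

Definition direct_sum_decomposition (A B : set M) : Prop :=
  [/\ is_submodule A, is_submodule B,
      forall x, exists a b, [/\ A a, B b & x = a + b] &
      A `&` B = [set 0]].

Definition persistently_reducible (a : M) : Prop :=
  forall t1, Tcomp t1 -> exists2 t2, Tcomp t2 & Irr (t2 (t1 a)).

Definition uniquely_reducible (a : M) : Prop :=
  forall t1 t2, Tcomp t1 -> Tcomp t2 ->
    Irr (t1 a) -> Irr (t2 a) -> t1 a = t2 a.

Definition DIS (mu : M) : set M :=
  Span [set x | exists nu t, [/\ Y nu, ltP P nu mu, T1 t & x = nu - t nu]].

Record triplet := Triplet { tleft : M -> M; tsite : M; tright : M -> M }.

Definition ambiguity (A : triplet) : Prop :=
  [/\ T1 (tleft A), T1 (tright A), Y (tsite A),
      tleft A (tsite A) <> tsite A & tright A (tsite A) <> tsite A].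

Definition swap (A : triplet) : triplet :=
  Triplet (tright A) (tsite A) (tleft A).

(* The triplets A and swap A stand for the same ambiguity. *)
Definition equiv_triplet (A B : triplet) : Prop := B = A \/ B = swap A.

Definition resolvable (A : triplet) : Prop :=
  exists t3 t4, [/\ Tcomp t3, Tcomp t4 &
    t3 (tleft A (tsite A)) = t4 (tright A (tsite A))].

Definition resolvable_rel (A : triplet) : Prop :=
  DIS (tsite A) (tleft A (tsite A) - tright A (tsite A)).

Definition shadow_triplet (A B : triplet) : Prop :=
  exists v, [/\ V v, tsite A = v (tsite B),
    tleft A (tsite A) = v (tleft B (tsite B)) &
    tright A (tsite A) = v (tright B (tsite B))].

(* Since swapping both triplets preserves shadow_triplet, it is enough to vary
   the representative of one of the two ambiguities. *)
Definition shadow (A B : triplet) : Prop :=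
  exists2 A', equiv_triplet A A' & shadow_triplet A' B.

Definition proper_shadow (A B : triplet) : Prop := shadow A B /\ ~ shadow B A.

Definition shadow_minimal (A : triplet) : Prop :=
  ambiguity A /\ forall B, ambiguity B -> ~ proper_shadow A B.

Definition shadow_critical (A : triplet) : Prop :=
  ambiguity A /\ forall B, shadow_minimal B -> ~ proper_shadow A B.

Definition scaled_basis : set M := [set b | exists r mu, Y mu /\ b = r *: mu].

Definition biadvanceable (w : M -> M -> M) : Prop :=
  [/\ forall b2, {morph w^~ b2 : x y / x + y},
      forall b1, {morph w b1 : x y / x + y} &
      forall b1 b2, scaled_basis b1 -> scaled_basis b2 ->
        (forall t1, T1 t1 ->
           exists2 t, Tcomp t & t (w b1 b2) = w (t1 b1) b2) /\
        (forall t2, Tcomp t2 ->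
           exists2 t, Tcomp t & t (w b1 b2) = w b1 (t2 b2))].

Definition VV_biadvanceable (w : M -> M -> M) : Prop :=
  biadvanceable w /\ (forall rho, Y rho -> V (w^~ rho) /\ V (w rho)).

Definition montage_triplet (A : triplet) : Prop :=
  exists lam t' nu u' w,
    [/\ Y lam /\ T1 t', Y nu /\ T1 u', VV_biadvanceable w,
        tsite A = w lam nu &
        tleft A (tsite A) = w (t' lam) nu /\
        tright A (tsite A) = w lam (u' nu)].

Definition montage (A : triplet) : Prop :=
  exists2 A', equiv_triplet A A' & montage_triplet A'.

Definition critical (A : triplet) : Prop := shadow_critical A /\ ~ montage A.

Definition LM (a : M) : set M :=
  [set mu | supp Y a mu /\ forall nu, supp Y a nu -> ~ ltP P mu nu].

(* lm_P(a) is defined and equal to mu *)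
Definition is_lm (a mu : M) : Prop := LM a = [set mu].

Definition P_monic (g : M) : Prop := exists mu, Y mu /\ DSM Y P mu (g - mu).

Definition V_ideal (N : set M) : Prop :=
  is_submodule N /\ forall v a, V v -> N a -> N (v a).

Definition P_monic_Groebner_basis (G N : set M) : Prop :=
  [/\ V_ideal N, forall g, G g -> P_monic g,
      forall v g, V v -> G g -> N (v g) &
      forall a mu, N a -> LM a mu ->
        exists g v lam, [/\ G g, V v, is_lm g lam & mu = v lam]].

End Reductions.

(* Main.v *)
Require Import Defs.
From HB Require Import structures.
From mathcomp Require Import all_boot all_order all_algebra.
From mathcomp Require Import all_classical.

Set Implicit Arguments.
Unset Strict Implicit.
Unset Printing Implicit Defensive.

Import GRing.Theory.
Local Open Scope classical_set_scope.
Local Open Scope ring_scope.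

(** Reductions never raise a basis element, so by well-founded induction the
persistently reducible elements, which form a submodule, are all of M.  The
uniquely reducible elements form a submodule too; if every ambiguity at mu is
resolvable relative to P and every nu < mu is uniquely reducible, then DIS(mu)
consists of elements reducible to 0, and the first nontrivial steps of any two
reductions of mu can be joined, so mu is uniquely reducible.

Restricting to critical ambiguities loses nothing: a montage ambiguity is
always resolvable relative to P, relative resolvability is transported by V
from an ambiguity to its shadows, and an ambiguity which is not shadow-critical
is a shadow of a shadow-minimal, hence shadow-critical, one.

A Groebner basis forbids a nonzero irreducible element in I(S), because its
support has a maximal element; conversely, reductions preserve an irreducible
maximal element of a support, so they cannot take such an element to 0. *)

(** * Submodules and spans as predicates on bare sets and maps *)

Section Submodules.
Variables (R : pzRingType) (M : lmodType R).
Implicit Types (A N : set M) (f g : M -> M).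

(** Elements of [V] and reductions are bare functions; bundling them gives access to the library
    lemmas on linear maps. *)
Lemma linear_ext f : linear f -> exists g : {linear M -> M}, f = g.
Proof.
move=> lf; pose L := GRing.isLinear.Build R M M _ f lf.
by pose g : {linear M -> M} := HB.pack f L; exists g.
Qed.

Lemma linear_comp f g : linear f -> linear g -> linear (f \o g).
Proof. by move=> lf lg r x y /=; rewrite lg lf. Qed.

Lemma is_submoduleP N :
  is_submodule N <-> N 0 /\ forall r x y, N x -> N y -> N (r *: x + y).
Proof.
split=> -[N0 NL]; split.
- by move: N0; rewrite inE.
- by move=> r x y Nx Ny; have := NL r x y; rewrite !inE; apply.
- by rewrite inE.
- by move=> r x y; rewrite !inE; apply: NL.
Qed.

Lemma submod0 N : is_submodule N -> N 0.
Proof. by move=> /is_submoduleP[]. Qed.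

Lemma submodP N r x y : is_submodule N -> N x -> N y -> N (r *: x + y).
Proof. by move=> /is_submoduleP[_]; apply. Qed.

Lemma submodD N x y : is_submodule N -> N x -> N y -> N (x + y).
Proof. by move=> sN Nx Ny; rewrite -[x]scale1r; apply: submodP. Qed.

Lemma submodZ N r x : is_submodule N -> N x -> N (r *: x).
Proof.
by move=> sN Nx; rewrite -[_ *: x]addr0; apply: submodP => //; apply: submod0.
Qed.

Lemma submodN N x : is_submodule N -> N x -> N (- x).
Proof. by move=> sN Nx; rewrite -scaleN1r; apply: submodZ. Qed.

Lemma submodB N x y : is_submodule N -> N x -> N y -> N (x - y).
Proof. by move=> sN Nx Ny; apply: submodD => //; apply: submodN. Qed.

Lemma submod_sum N (I : eqType) (s : seq I) (F : I -> M) :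
  is_submodule N -> (forall i, i \in s -> N (F i)) -> N (\sum_(i <- s) F i).
Proof.
move=> sN NF; rewrite big_seq; apply: (big_ind N) => //; first exact: submod0.
by move=> x y; apply: submodD.
Qed.

Lemma submodule_preimage f N :
  linear f -> is_submodule N -> is_submodule (f @^-1` N).
Proof.
move=> lf sN; have [g fE] := linear_ext lf.
apply/is_submoduleP; split=> [|r x y /= Nx Ny].
  by rewrite /= fE linear0; apply: submod0.
by rewrite lf; apply: submodP.
Qed.

Lemma linear_idB f : linear f -> linear (fun x => x - f x).
Proof. by move=> lf r x y; rewrite lf scalerBr addrACA opprD. Qed.

Lemma Span_submodule A : is_submodule (Span A).
Proof.
apply/is_submoduleP; split=> [N [sN _]|r x y Ax Ay N [sN AN]].
  exact: submod0.
by apply: submodP => //; [apply: Ax|apply: Ay].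
Qed.

Lemma sub_Span A : A `<=` Span A.
Proof. exact: sub_gen_smallest. Qed.

Lemma Span_min A N : is_submodule N -> A `<=` N -> Span A `<=` N.
Proof. exact: smallest_sub. Qed.

Lemma Span_image f A N : linear f -> is_submodule N ->
  (forall x, A x -> N (f x)) -> forall x, Span A x -> N (f x).
Proof.
by move=> lf sN AN; apply: Span_min => //; apply: submodule_preimage.
Qed.

End Submodules.

(** * Coefficients with respect to a basis *)

Section Coordinates.
Variables (R : pzRingType) (M : lmodType R) (Y : set M).
Implicit Types (a b lam mu : M) (c d : M -> R).

(** Lets two families carried by different lists be added over one common list. *)
Lemma sum_coords_widen c (s s' : seq M) : uniq s -> uniq s' ->
  {subset s <= s'} -> (forall x, x \notin s -> c x = 0) ->
  \sum_(x <- s) c x *: x = \sum_(x <- s') c x *: x.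
Proof.
move=> us us' ss' c0; rewrite [RHS](bigID (mem s)) /=.
rewrite [X in _ = _ + X]big1 ?addr0; last first.
  by move=> x xs; rewrite c0 ?scale0r.
rewrite -[RHS]big_filter; apply/perm_big/uniq_perm; rewrite ?filter_uniq//.
move=> x; rewrite mem_filter /=.
by case: (boolP (x \in s)) => // /ss' ->.
Qed.

Lemma is_coords_lin r a b c d : is_coords Y a c -> is_coords Y b d ->
  is_coords Y (r *: a + b) (fun x => r * c x + d x).
Proof.
move=> [s [us Ys c0 ->]] [s' [us' Ys' d0 ->]].
exists (undup (s ++ s')); split.
- exact: undup_uniq.
- by move=> x; rewrite mem_undup mem_cat => /orP[/Ys|/Ys'].
- move=> x; rewrite mem_undup mem_cat negb_or => /andP[/c0 -> /d0 ->].
  by rewrite mulr0 addr0.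
rewrite (@sum_coords_widen c s (undup (s ++ s'))) ?undup_uniq//; last first.
  by move=> x xs; rewrite mem_undup mem_cat xs.
rewrite (@sum_coords_widen d s' (undup (s ++ s'))) ?undup_uniq//; last first.
  by move=> x xs; rewrite mem_undup mem_cat xs orbT.
rewrite scaler_sumr -big_split /=; apply: eq_bigr => x _.
by rewrite scalerDl scalerA.
Qed.

Lemma is_coords_basis mu : Y mu -> is_coords Y mu (fun x => (x == mu)%:R).
Proof.
move=> Ymu; exists [:: mu]; split=> //.
- by move=> x; rewrite inE => /eqP ->.
- by move=> x; rewrite inE => /negbTE ->.
- by rewrite big_seq1 eqxx scale1r.
Qed.

Hypothesis Ybasis : is_basis Y.

(** The difference of the two families represents 0: independence annihilates it on its list, and it
    vanishes elsewhere by definition. *)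
Lemma is_coords_inj a c d : is_coords Y a c -> is_coords Y a d -> c = d.
Proof.
move=> ac ad; have := is_coords_lin (- 1) ac ad.
rewrite scaleN1r addNr => -[s [us Ys e0 sum0]]; apply/funext => x.
have : - 1 * c x + d x = 0.
  have [xs|/e0 //] := boolP (x \in s).
  by have := Ybasis.1 s (fun x => - 1 * c x + d x) us Ys (esym sum0) x xs.
by rewrite mulN1r addrC => /eqP; rewrite subr_eq0 => /eqP.
Qed.

Lemma is_coords_exists a : exists c, is_coords Y a c.
Proof.
have : Span Y a by rewrite Ybasis.2.
apply: (@Span_min _ _ _ [set a | exists c, is_coords Y a c]).
  apply/is_submoduleP; split=> [|r x y [c xc] [d yd]].
    by exists (fun=> 0), [::]; split=> //; rewrite big_nil.
  by eexists; apply: is_coords_lin xc yd.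
by move=> mu Ymu; eexists; apply: is_coords_basis.
Qed.

Lemma coefYE a c lam : is_coords Y a c -> coef Y lam a = c lam.
Proof.
move=> ac; apply: xget_unique; first by exists c.
by move=> r [d ad ->]; rewrite (is_coords_inj ac ad).
Qed.

Lemma coefYP lam r a b :
  coef Y lam (r *: a + b) = r * coef Y lam a + coef Y lam b.
Proof.
have [c ac] := is_coords_exists a; have [d bd] := is_coords_exists b.
by rewrite (coefYE _ ac) (coefYE _ bd) (coefYE _ (is_coords_lin r ac bd)).
Qed.

Lemma coefY0 lam : coef Y lam 0 = 0.
Proof.
by have := coefYP lam (- 1) 0 0; rewrite scaler0 addr0 mulN1r addNr.
Qed.

Lemma coefYB lam a b : coef Y lam (a - b) = coef Y lam a - coef Y lam b.
Proof. by rewrite addrC -scaleN1r coefYP mulN1r addrC. Qed.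

Lemma coefYZ lam r a : coef Y lam (r *: a) = r * coef Y lam a.
Proof. by rewrite -[_ *: a]addr0 coefYP coefY0 addr0. Qed.

Lemma coef_basis lam mu : Y mu -> coef Y lam mu = (lam == mu)%:R.
Proof. by move=> /is_coords_basis/coefYE. Qed.

Lemma coef_decomposition a : exists s : seq M,
  [/\ forall x, x \in s -> Y x, forall x, x \notin s -> coef Y x a = 0 &
      a = \sum_(x <- s) coef Y x a *: x].
Proof.
have [c ac] := is_coords_exists a; have [s [us Ys c0 aE]] := ac.
exists s; split=> // [x xs|]; first by rewrite (coefYE _ ac) c0.
by rewrite {1}aE; apply: eq_bigr => x _; rewrite (coefYE _ ac).
Qed.

(** Both reducibility properties define submodules, so this leaves only basis elements to treat,
    where well-founded induction is available. *)
Lemma submodule_basis N : is_submodule N -> Y `<=` N -> forall a, N a.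
Proof.
move=> sN YN a; have : Span Y a by rewrite Ybasis.2.
exact: Span_min.
Qed.

End Coordinates.

(** * Well-founded induction and maximal elements *)

Section WellFoundedOrder.
Variables (T : Type) (Y : set T) (P : T -> T -> Prop).

Lemma ltP_trans : partial_order_on Y P -> forall x y z, Y x -> Y y -> Y z ->
  Defs.ltP P x y -> Defs.ltP P y z -> Defs.ltP P x z.
Proof.
move=> [_ Panti Ptr] x y z Yx Yy Yz [Pxy nxy] [Pyz nyz].
split; first exact: Ptr Pxy Pyz.
by move=> xz; apply: nyz; apply: Panti => //; rewrite -xz.
Qed.

Lemma well_founded_on_ind : well_founded_on Y P -> forall Q : T -> Prop,
  (forall x, Y x -> (forall y, Y y -> Defs.ltP P y x -> Q y) -> Q x) ->
  forall x, Y x -> Q x.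
Proof.
move=> Pwf Q step x Yx; apply: contrapT => nQx.
(* Below each counterexample there is a smaller one; iterating the choice function [f] from [x]
   gives an infinite descending sequence. *)
have /choice[f fP] : forall y, exists z, Y y /\ ~ Q y ->
    [/\ Y z, ~ Q z & Defs.ltP P z y].
  move=> y; have [[z zP]|nz] :=
    pselect (exists z, [/\ Y z, ~ Q z & Defs.ltP P z y]); first by exists z.
  exists y => -[Yy nQy]; exfalso; apply: nQy; apply: step => // z Yz zy.
  by apply: contrapT => nQz; apply: nz; exists z.
pose u n := iter n f x.
have uP n : Y (u n) /\ ~ Q (u n).
  by elim: n => //= n /fP[].
apply: (Pwf u) => [n|n]; first by have [] := uP n.
by have [] := fP _ (uP n).
Qed.

End WellFoundedOrder.

(** Applied to the finite support of an element. The maximal element of the tail is kept unless the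
    new head exceeds it, and then the head is maximal by transitivity. *)
Lemma maximal_exists (T : eqType) (Y : set T) (P : T -> T -> Prop) (s : seq T) :
  partial_order_on Y P -> (forall x, x \in s -> Y x) -> s <> [::] ->
  exists2 x, x \in s & forall y, y \in s -> ~ Defs.ltP P x y.
Proof.
move=> Po; elim: s => // x s IHs Ys _.
have [->|s0] := eqVneq s [::].
  by exists x; rewrite ?mem_head// => y; rewrite inE => /eqP -> [].
have [|m ms mmax] := IHs _ (elimN eqP s0).
  by move=> y ys; apply: Ys; rewrite inE ys orbT.
have Yx : Y x by apply/Ys/mem_head.
have Yt y : y \in s -> Y y by move=> ys; apply: Ys; rewrite inE ys orbT.
have [mx|nmx] := pselect (Defs.ltP P m x).
  exists x; first exact: mem_head.
  move=> y; rewrite inE => /orP[/eqP -> []//|ys xy].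
  by apply: (mmax y ys); apply: (ltP_trans Po _ _ _ mx xy) => //; apply: Yt.
exists m; first by rewrite inE ms orbT.
by move=> y; rewrite inE => /orP[/eqP ->|/mmax].
Qed.

(** * The monoid [V], the order, and the submodules [DSM] and [DIS] *)

Section Reduction.
Variables (R : pzRingType) (M : lmodType R) (Y : set M) (P : M -> M -> Prop).
Variables (V : set (M -> M)) (S : set (M * M)).
Hypotheses (Ybasis : is_basis Y) (Porder : partial_order_on Y P).
Hypotheses (Pwf : well_founded_on Y P) (Vmonoid : monotone_hom_monoid Y P V).
Hypothesis Ssub : forall mu a, S (mu, a) -> Y mu /\ DSM Y P mu a.

Local Notation T1 := (T1 Y V S).
Local Notation Tcomp := (Tcomp Y V S).
Local Notation Irr := (Irr Y V S).
Local Notation IS := (IS Y V S).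
Local Notation DSM := (DSM Y P).
Local Notation DIS := (DIS Y P V S).
Local Notation coef := (coef Y).
Local Notation red := (simple_reduction Y).
Implicit Types (a b x y mu nu lam : M) (t u : M -> M).

Lemma V_linear v : V v -> linear v.
Proof. by have [_ _ + _ _] := Vmonoid; apply. Qed.

Lemma V_basis v mu : V v -> Y mu -> Y (v mu).
Proof. by have [_ _ _ + _] := Vmonoid => /[apply]; apply. Qed.

Lemma V_lt v mu nu : V v -> Y mu -> Y nu -> Defs.ltP P nu mu ->
  Defs.ltP P (v nu) (v mu).
Proof. by have [_ _ _ _ +] := Vmonoid => /[apply]; apply. Qed.

Lemma V_comp v w : V v -> V w -> V (v \o w).
Proof. by have [_ + _ _ _] := Vmonoid; apply. Qed.

Lemma VB v x y : V v -> v (x - y) = v x - v y.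
Proof. by move=> /V_linear/linear_ext[g ->]; rewrite linearB. Qed.

Lemma VZ v r x : V v -> v (r *: x) = r *: v x.
Proof. by move=> /V_linear/linear_ext[g ->]; rewrite linearZ. Qed.

Lemma DSM_submodule mu : is_submodule (DSM mu).
Proof. exact: Span_submodule. Qed.

Lemma DIS_submodule mu : is_submodule (DIS mu).
Proof. exact: Span_submodule. Qed.

Lemma DSM_basis mu nu : Y nu -> Defs.ltP P nu mu -> DSM mu nu.
Proof. by move=> Ynu lt; apply: sub_Span. Qed.

Lemma DSM_le mu nu x : Y mu -> Y nu -> Defs.ltP P nu mu -> DSM nu x -> DSM mu x.
Proof.
move=> Ymu Ynu lt; apply: Span_min; first exact: DSM_submodule.
move=> lam [Ylam ltl]; apply: DSM_basis => //.
exact: (ltP_trans Porder) ltl lt.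
Qed.

(** For fixed [nu], the elements satisfying this implication form a submodule that contains the
    generators of [DSM mu]. *)
Lemma DSM_coef mu nu x : DSM mu x -> coef nu x <> 0 -> Defs.ltP P nu mu.
Proof.
pose N := [set x | coef nu x <> 0 -> Defs.ltP P nu mu].
apply: (@Span_min _ _ _ N) => [|lam [Ylam lt]]; rewrite /N /=; last first.
  by rewrite coef_basis//; case: eqP => [->|].
apply/is_submoduleP; split=> /= [|r u w uN wN]; first by rewrite coefY0.
rewrite coefYP//; have [/uN//|/contrapT ->] := pselect (coef nu u <> 0).
by rewrite mulr0 add0r.
Qed.

Lemma DSM_coef0 mu x : DSM mu x -> coef mu x = 0.
Proof. by move=> xmu; apply: contrapT => /(DSM_coef xmu)[]. Qed.

Lemma V_DSM v mu x : V v -> Y mu -> DSM mu x -> DSM (v mu) (v x).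
Proof.
move=> Vv Ymu; apply: Span_image; [exact: V_linear|exact: DSM_submodule|].
move=> nu [Ynu lt]; apply: DSM_basis; first exact: V_basis.
exact: V_lt.
Qed.

(** * Simple reductions and their compositions *)

Lemma rule_basis s : S s -> Y s.1.
Proof. by case: s => mu a /Ssub[]. Qed.

Lemma rule_DSM s : S s -> DSM s.1 s.2.
Proof. by case: s => mu a /Ssub[]. Qed.

(** By monotonicity [v s.2] lies in [DSM (v s.1)], so it does not contribute at [v s.1]. *)
Lemma rule_coef v s : V v -> S s -> coef (v s.1) (v (s.1 - s.2)) = 1.
Proof.
move=> Vv Ss; have Ys := rule_basis Ss; rewrite VB// coefYB// coef_basis//.
  by rewrite eqxx (DSM_coef0 (V_DSM _ _ (rule_DSM Ss)))// subr0.
exact: V_basis.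
Qed.

Lemma rule_coef_le v s nu : V v -> S s -> coef nu (v (s.1 - s.2)) <> 0 ->
  nu = v s.1 \/ Defs.ltP P nu (v s.1).
Proof.
move=> Vv Ss; have Ys := rule_basis Ss.
rewrite VB// coefYB// (coef_basis Ybasis _ (V_basis Vv Ys)).
have [->|_] := eqVneq nu (v s.1); first by left.
rewrite sub0r => cn; right; apply: DSM_coef (V_DSM Vv Ys (rule_DSM Ss)) _.
by move=> c0; apply: cn; rewrite c0 oppr0.
Qed.

Lemma red_T1 v s : V v -> S s -> T1 (red v s).
Proof. by move=> Vv Ss; exists v, s. Qed.

Lemma red_site v s : V v -> S s -> red v s (v s.1) = v s.2.
Proof.
move=> Vv Ss; have Ys := rule_basis Ss; rewrite /red coef_basis//.
  by rewrite eqxx scale1r VB// subKr.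
exact: V_basis.
Qed.

Lemma red_other v s mu : Y mu -> mu <> v s.1 -> red v s mu = mu.
Proof.
move=> Ymu ne; rewrite /red coef_basis//; case: eqP => [/esym//|].
by rewrite scale0r subr0.
Qed.

Lemma T1_linear t : T1 t -> linear t.
Proof.
move=> [v [s [_ _ ->]]] r x y; rewrite /simple_reduction coefYP// scalerDl.
by rewrite scalerBr scalerA opprD addrACA.
Qed.

Lemma Tcomp_linear t : Tcomp t -> linear t.
Proof. by elim=> [//|t' u /T1_linear lt _]; apply: linear_comp. Qed.

Lemma TcompB t x y : Tcomp t -> t (x - y) = t x - t y.
Proof. by move=> /Tcomp_linear/linear_ext[g ->]; rewrite linearB. Qed.

Lemma TcompP t r x y : Tcomp t -> t (r *: x + y) = r *: t x + t y.
Proof. by move=> /Tcomp_linear; apply. Qed.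

Lemma Tcomp0 t : Tcomp t -> t 0 = 0.
Proof. by move=> /Tcomp_linear/linear_ext[g ->]; rewrite linear0. Qed.

Lemma Tcomp_T1 t : T1 t -> Tcomp t.
Proof. by move=> tT; apply: (Tcomp_cons tT (Tcomp_id _ _ _)). Qed.

Lemma Tcomp_comp t u : Tcomp t -> Tcomp u -> Tcomp (t \o u).
Proof. by elim=> [//|t1 t2 t1T _ IH /IH]; apply: Tcomp_cons. Qed.

(** The only basis element that [red v s] can move is [v s.1], and it is replaced by [v s.2]. *)
Lemma T1_DSM_basis t mu : T1 t -> Y mu -> t mu <> mu -> DSM mu (t mu).
Proof.
move=> [v [s [Vv Ss ->]]] Ymu.
have [->|ne] := eqVneq mu (v s.1); last by rewrite red_other//; apply/eqP.
move=> _; rewrite red_site//.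
by apply: V_DSM; [|apply: rule_basis|apply: rule_DSM].
Qed.

Lemma T1_DSM t mu x : Y mu -> T1 t -> DSM mu x -> DSM mu (t x).
Proof.
move=> Ymu tT; apply: Span_image; [exact: T1_linear|exact: DSM_submodule|].
move=> nu [Ynu lt]; have [->|ne] := pselect (t nu = nu); first exact: DSM_basis.
by apply: DSM_le lt _ => //; apply: T1_DSM_basis.
Qed.

Lemma T1_DIS t mu x : T1 t -> DSM mu x -> DIS mu (x - t x).
Proof.
move=> tT; apply: (@Span_image _ _ (fun x => x - t x)).
- exact/linear_idB/T1_linear.
- exact: DIS_submodule.
- by move=> nu [Ynu lt]; apply: sub_Span; exists nu, t.
Qed.

(** The difference telescopes over the simple steps; each intermediate value stays in [DSM mu], so
    [T1_DIS] covers every step. *)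
Lemma Tcomp_DIS t mu x : Y mu -> Tcomp t -> DSM mu x -> DIS mu (x - t x).
Proof.
move=> Ymu tT xmu; suff [] : DSM mu (t x) /\ DIS mu (x - t x) by [].
elim: tT => [|t1 u t1T _ [ux xux]] /=.
  by split=> //; rewrite subrr; exact: submod0 (DIS_submodule _).
split; first exact: T1_DSM.
rewrite -(subrKA (u x)); apply: (submodD (DIS_submodule _)) => //.
exact: T1_DIS.
Qed.

(** * Irreducible elements and the submodule [IS] *)

Lemma IrrP a : Irr a <-> forall t, T1 t -> t a = a.
Proof.
split=> [aI t /Tcomp_T1/aI //|aI t]; elim=> // t1 u t1T _ /= ->; exact: aI.
Qed.

(** A reduction subtracts a multiple of an element whose coefficient at the site is 1, so it acts
    trivially only if the multiplier is 0. *)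
Lemma Irr_coefP a : Irr a <-> forall v s, V v -> S s -> coef (v s.1) a = 0.
Proof.
split=> [/IrrP aI v s Vv Ss|aI]; last first.
  apply/IrrP => t [v [s [Vv Ss ->]]].
  by rewrite /simple_reduction aI// scale0r subr0.
have /(congr1 (fun x => coef (v s.1) x)) := aI _ (red_T1 Vv Ss).
rewrite /simple_reduction coefYB// coefYZ// rule_coef// mulr1 => /eqP.
by rewrite subrr eq_sym => /eqP.
Qed.

Lemma Irr_submodule : is_submodule Irr.
Proof.
apply/is_submoduleP; split=> [t /Tcomp0 //|r x y xI yI t tT].
by rewrite TcompP// xI// yI.
Qed.

Lemma IS_submodule : is_submodule IS.
Proof.
apply/is_submoduleP; split.
  by exists 0, (fun=> id), (fun=> 0); split=> [[]//|]; rewrite big_ord0.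
move=> r _ _ [n [t [b [tT ->]]]] [m [u [c [uT ->]]]].
(* The two families are concatenated, and the scalar [r] is moved into the elements [b j] of the
   first one. *)
pose tu (i : 'I_(n + m)) :=
  match fintype.split i with inl j => t j | inr k => u k end.
pose bc (i : 'I_(n + m)) :=
  match fintype.split i with inl j => r *: b j | inr k => c k end.
exists (n + m)%N, tu, bc; split=> [i|].
  by rewrite /tu; case: fintype.split.
rewrite big_split_ord /= scaler_sumr; congr (_ + _); apply: eq_bigr => i _.
  rewrite /tu /bc (unsplitK (inl i)) scalerBr; congr (_ - _).
  by have /Tcomp_linear/linear_ext[g ->] := tT i; rewrite linearZ.
by rewrite /tu /bc (unsplitK (inr i)).
Qed.

Lemma IS_sub t b : Tcomp t -> IS (b - t b).
Proof.
by move=> tT; exists 1, (fun=> t), (fun=> b); split=> //; rewrite big_ord1.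
Qed.

(** Together with [IS_rule], this identifies [IS] as the span of the elements [v (s.1 - s.2)]: the
    difference [b - t b] telescopes into multiples of them. *)
Lemma IS_min N : is_submodule N ->
  (forall v s, V v -> S s -> N (v (s.1 - s.2))) -> IS `<=` N.
Proof.
move=> sN NT _ [n [t [b [tT ->]]]]; apply: submod_sum => // i _.
elim: (tT i) => [|t1 u [v [s [Vv Ss ->]]] _ IH] /=.
  by rewrite subrr; apply: submod0.
rewrite -(subrKA (u (b i))); apply: submodD => //.
by rewrite subKr; apply: submodZ => //; apply: NT.
Qed.

Lemma IS_rule v s : V v -> S s -> IS (v (s.1 - s.2)).
Proof.
by move=> Vv Ss; rewrite VB// -(red_site Vv Ss); apply/IS_sub/Tcomp_T1/red_T1.
Qed.

Lemma IS_V_ideal : V_ideal V IS.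
Proof.
split=> [|v a Vv]; first exact: IS_submodule.
apply: (@IS_min (v @^-1` IS)) => [|w s Vw Ss].
  exact: submodule_preimage (V_linear Vv) IS_submodule.
exact: (IS_rule (V_comp Vv Vw) Ss).
Qed.

(** * Persistent reducibility *)

(** Discards the simple steps that fix [mu] before the first one that moves it, after which the
    value lies in [DSM mu]. *)
Lemma first_reduction t mu : Tcomp t -> t mu = mu \/
  exists t1 t2, [/\ T1 t1, Tcomp t2, t1 mu <> mu & t mu = t2 (t1 mu)].
Proof.
elim=> [|t1 u t1T uT [umu|[u1 [u2 [u1T u2T une uE]]]]]; first by left.
- have [tmu|tne] := pselect (t1 mu = mu); first by left; rewrite /= umu.
  right; exists t1, id; split=> //=; last by rewrite umu.
  exact: Tcomp_id.
- right; exists u1, (t1 \o u2); split=> //=; last by rewrite uE.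
  exact: Tcomp_cons.
Qed.

Lemma persistent_submodule : is_submodule (persistently_reducible Y V S).
Proof.
apply/is_submoduleP; split=> [t /Tcomp0 ->|r x y xp yp t tT].
  by exists id; [exact: Tcomp_id|exact: submod0 Irr_submodule].
have [t2 t2T t2x] := xp t tT.
(* [t3] is chosen for [y] after [t2] has acted; it fixes the part coming from [x], which is already
   irreducible. *)
have [t3 t3T t3y] := yp _ (Tcomp_comp t2T tT).
exists (t3 \o t2); first exact: Tcomp_comp.
rewrite /= TcompP// TcompP// TcompP// (t2x t3)//.
by apply: (submodP _ Irr_submodule).
Qed.

Lemma all_persistent a : persistently_reducible Y V S a.
Proof.
apply: (submodule_basis Ybasis persistent_submodule) => {}a Ya.
move: a Ya; apply: (well_founded_on_ind Pwf) => mu Ymu IH.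
have DSMp x : DSM mu x -> persistently_reducible Y V S x.
  apply: Span_min; first exact: persistent_submodule.
  by move=> nu [Ynu lt]; apply: IH.
move=> t tT; have [->|[t1 [t2 [t1T t2T ne ->]]]] := first_reduction mu tT.
  have [muI|/IrrP/existsNP[t1 /not_implyP[t1T ne]]] := pselect (Irr mu).
    by exists id => //; exact: Tcomp_id.
  have [t2 t2T t2I] := DSMp _ (T1_DSM_basis t1T Ymu ne) _ (Tcomp_id _ _ _).
  by exists (t2 \o t1) => //; apply/Tcomp_comp/Tcomp_T1.
exact: DSMp (T1_DSM_basis t1T Ymu ne) t2 t2T.
Qed.

Lemma reduces_to_Irr a : exists2 t, Tcomp t & Irr (t a).
Proof. exact: (all_persistent a (Tcomp_id _ _ _)). Qed.

(** * Unique reducibility and reduction to zero *)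

Local Notation unique := (uniquely_reducible Y V S).

Lemma unique_Tcomp t x : Tcomp t -> unique x -> unique (t x).
Proof.
move=> tT xu t1 t2 t1T t2T.
by apply: (xu (t1 \o t) (t2 \o t)); apply: Tcomp_comp.
Qed.

Lemma unique_submodule : is_submodule unique.
Proof.
apply/is_submoduleP; split=> [t u tT uT _ _|r x y xu yu t u tT uT].
  by rewrite !Tcomp0.
(* A reduction making the sum irreducible is prolonged until both summands are irreducible as well;
   the prolongation does not change its value on the sum. *)
have refine w : Tcomp w -> Irr (w (r *: x + y)) -> exists w',
    [/\ Tcomp w', Irr (w' x), Irr (w' y) &
        w (r *: x + y) = r *: w' x + w' y].
  move=> wT wI; have [w1 w1T w1I] := reduces_to_Irr (w x).
  have [w2 w2T w2I] := reduces_to_Irr (w1 (w y)).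
  exists (w2 \o (w1 \o w)); split=> //=.
  - exact: (Tcomp_comp w2T (Tcomp_comp w1T wT)).
  - by rewrite w1I.
  - by rewrite -!TcompP// wI// wI.
move=> /(refine _ tT)[t' [t'T t'x t'y ->]] /(refine _ uT)[u' [u'T u'x u'y ->]].
by rewrite (xu t' u')// (yu t' u').
Qed.

(** Uniqueness is built in to obtain closure under addition: once a reduction has annihilated one
    summand, the image of the other can still be reduced to 0. *)
Definition null_reducible : set M :=
  [set x | unique x /\ exists2 t, Tcomp t & t x = 0].

Lemma null_reducible_submodule : is_submodule null_reducible.
Proof.
have sU := unique_submodule.
apply/is_submoduleP; split=> [|r x y [xu [t tT tx]] [yu [u uT uy]]].
  by split; [exact: submod0|exists id => //; exact: Tcomp_id].
split; first exact: submodP sU _ _.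
have [w wT wI] := reduces_to_Irr (t y); exists (w \o t).
  exact: Tcomp_comp.
rewrite /= TcompP// TcompP// tx Tcomp0// scaler0 add0r -uy.
apply: (yu (w \o t) u) => //; first exact: Tcomp_comp.
by rewrite uy; exact: submod0 Irr_submodule.
Qed.

(** Irreducible values reached from [x] and from [t x] are both reached from [x], hence agree;
    [w \o u] makes both terms irreducible at once. *)
Lemma null_reducible_sub t x : Tcomp t -> unique x -> null_reducible (x - t x).
Proof.
move=> tT xu; split.
  by apply: (submodB unique_submodule) => //; apply: unique_Tcomp.
have [u uT uI] := reduces_to_Irr (t x); have [w wT wI] := reduces_to_Irr (u x).
exists (w \o u); first exact: Tcomp_comp.
rewrite /= TcompB// TcompB//; apply/eqP; rewrite subr_eq0; apply/eqP.
rewrite (uI w)//; apply: (xu (w \o u) (u \o t)) => //; exact: Tcomp_comp.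
Qed.

Lemma Irr_null_reducible x : Irr x -> null_reducible x -> x = 0.
Proof. by move=> xI [_ [t /xI ->]]. Qed.

Lemma DIS_null_reducible mu x : (forall y, DSM mu y -> unique y) ->
  DIS mu x -> null_reducible x.
Proof.
move=> DSMu; apply: Span_min; first exact: null_reducible_submodule.
move=> _ [nu [t [Ynu lt tT ->]]].
exact: null_reducible_sub (Tcomp_T1 tT) (DSMu _ (DSM_basis Ynu lt)).
Qed.

Lemma IS_null_reducible : (forall a, unique a) -> IS `<=` null_reducible.
Proof.
move=> allu; apply: IS_min; first exact: null_reducible_submodule.
move=> v s Vv Ss; rewrite VB// -(red_site Vv Ss).
exact: null_reducible_sub (Tcomp_T1 (red_T1 Vv Ss)) (allu _).
Qed.

Lemma resolvable_rel_unique :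
  (forall A, ambiguity Y V S A -> resolvable_rel Y P V S A) ->
  forall a, unique a.
Proof.
move=> resolve; apply: (submodule_basis Ybasis unique_submodule).
apply: (well_founded_on_ind Pwf) => mu Ymu IH.
have DSMu x : DSM mu x -> unique x.
  apply: Span_min; first exact: unique_submodule.
  by move=> nu [Ynu lt]; apply: IH.
have irr t : Tcomp t -> Irr mu -> t mu = mu by move=> tT; apply.
move=> t u tT uT.
(* If one of the reductions fixes [mu], then [mu] is itself irreducible and the other must fix it
   too. *)
have [tE|[t1 [t2 [t1T t2T tne ->]]]] := first_reduction mu tT.
  by rewrite tE => /[dup] /(irr u uT) ->.
have [uE|[u1 [u2 [u1T u2T une ->]]]] := first_reduction mu uT.
  rewrite uE => _ muI; case: tne; apply: muI; exact: Tcomp_T1.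
move=> tI uI; have [t1mu u1mu] :=
  (T1_DSM_basis t1T Ymu tne, T1_DSM_basis u1T Ymu une).
have [|_ [w wT]] :=
  DIS_null_reducible DSMu (resolve (Triplet t1 mu u1) _) => //=.
rewrite TcompB// => /eqP; rewrite subr_eq0 => /eqP wE.
(* [w] joins the two first steps and [w'] continues to an irreducible element. Uniqueness below [mu]
   identifies that element with both final values. *)
have [w' w'T w'I] := reduces_to_Irr (w (t1 mu)).
have w'wT : Tcomp (w' \o w) by exact: Tcomp_comp.
have w'I' : Irr (w' (w (u1 mu))) by rewrite -wE.
by rewrite (DSMu _ t1mu t2 (w' \o w))// (DSMu _ u1mu u2 (w' \o w))//= wE.
Qed.

(** * Shadows, montages and critical ambiguities *)

(** A generator of [DIS mu] is either 0 or comes from a reduction [red w s] at its site; [v] carries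
    the latter to the generator given by [red (v \o w) s]. *)
Lemma V_DIS v mu x : V v -> Y mu -> DIS mu x -> DIS (v mu) (v x).
Proof.
move=> Vv Ymu; apply: Span_image; [exact: V_linear|exact: DIS_submodule|].
move=> _ [nu [_ [Ynu lt [w [s [Vw Ss ->]]] ->]]].
have [nuE|/eqP ne] := eqVneq nu (w s.1); last first.
  rewrite red_other// subrr -(scale0r 0) VZ// scale0r.
  exact: submod0 (DIS_submodule _).
apply: sub_Span; exists (v nu), (red (v \o w) s); split.
- exact: V_basis.
- exact: V_lt.
- exact/red_T1/Ss/V_comp.
- by rewrite VB// nuE red_site// (red_site (V_comp Vv Vw) Ss).
Qed.

Lemma resolvable_rel_swap A :
  resolvable_rel Y P V S (swap A) -> resolvable_rel Y P V S A.
Proof.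
move=> rA; rewrite /resolvable_rel -opprB.
by apply: (submodN (DIS_submodule _)); exact: rA.
Qed.

Lemma resolvable_rel_shadow A B : Y (tsite B) -> shadow V A B ->
  resolvable_rel Y P V S B -> resolvable_rel Y P V S A.
Proof.
move=> YB [A' AA' [v [Vv sE lE rE]]] resB.
have resA' : resolvable_rel Y P V S A'.
  by rewrite /resolvable_rel lE rE -VB// sE; apply: V_DIS.
by case: AA' resA' => -> //; apply: resolvable_rel_swap.
Qed.

(* Both sides are compared with w(t'(lam), u'(nu)). As w is only additive, the
   two spans are traversed with an arbitrary scalar carried inside w. *)
Lemma resolvable_rel_montage A : ambiguity Y V S A -> montage Y V S A ->
  resolvable_rel Y P V S A.
Proof.
move=> Aamb [A' AA' mA'].
have A'amb : ambiguity Y V S A'.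
  by case: AA' => -> //; case: Aamb => ? ? ? ? ?; split.
suff resA' : resolvable_rel Y P V S A'.
  by case: AA' resA' => -> //; apply: resolvable_rel_swap.
have [_ _ Ymu lne rne] := A'amb.
have [lam [t [nu [u [w [[Ylam tT] [Ynu uT] [[wDl wDr adv] wV] muE [lE rE]]]]]]]
  := mA'.
rewrite /resolvable_rel lE rE; set mu := tsite A' in Ymu lne rne muE lE rE *.
have tlam : DSM lam (t lam).
  by apply: T1_DSM_basis => // tE; apply: lne; rewrite lE tE.
have unu : DSM nu (u nu).
  by apply: T1_DSM_basis => // uE; apply: rne; rewrite rE uE.
have [Vl _] := wV nu Ynu; have [_ Vr] := wV lam Ylam.
have sD := DIS_submodule mu.
have scaled r rho : Y rho -> scaled_basis Y (r *: rho).
  by move=> Yrho; exists r, rho.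
have scaled1 rho : Y rho -> scaled_basis Y rho.
  by move=> Yrho; exists 1, rho; rewrite scale1r.
have left_part r : DIS mu (w (r *: t lam) nu - w (r *: t lam) (u nu)).
  move: (t lam) tlam r; apply: Span_min => [|lam' [Ylam' lt] r].
    apply/is_submoduleP; split=> [r|c x y xD yD r] /=.
      have w0 z : w 0 z = 0.
        by apply: (addrI (w 0 z)); rewrite -wDl !addr0.
      by rewrite scaler0 !w0 subrr; exact: submod0 sD.
    by rewrite scalerDr scalerA !wDl opprD addrACA; apply: (submodD sD).
  (* Applying [u] in the second argument amounts to a reduction [z] of [w (r *: lam') nu], which is
     a multiple of a basis element below [mu] because [w^~ nu] lies in [V]. *)
  have [_ /(_ u (Tcomp_T1 uT))[z zT <-]] :=
    adv _ _ (scaled r _ Ylam') (scaled1 _ Ynu).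
  apply: Tcomp_DIS => //; rewrite (VZ _ _ Vl) /=.
  apply: (submodZ _ (DSM_submodule _)).
  apply: DSM_basis; first exact: (V_basis Vl Ylam').
  by rewrite muE; apply: (V_lt Vl).
have right_part r : DIS mu (w lam (r *: u nu) - w (t lam) (r *: u nu)).
  move: (u nu) unu r; apply: Span_min => [|nu' [Ynu' lt] r].
    apply/is_submoduleP; split=> [r|c x y xD yD r] /=.
      have w0 z : w z 0 = 0.
        by apply: (addrI (w z 0)); rewrite -wDr !addr0.
      by rewrite scaler0 !w0 subrr; exact: submod0 sD.
    by rewrite scalerDr scalerA !wDr opprD addrACA; apply: (submodD sD).
  have [/(_ t tT)[z zT <-] _] := adv _ _ (scaled1 _ Ylam) (scaled r _ Ynu').
  apply: Tcomp_DIS => //; rewrite (VZ _ _ Vr) /=.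
  apply: (submodZ _ (DSM_submodule _)).
  apply: DSM_basis; first exact: (V_basis Vr Ynu').
  by rewrite muE; apply: (V_lt Vr).
rewrite -(subrKA (w (t lam) (u nu))); apply: (submodD sD).
  by have := left_part 1; rewrite !scale1r.
rewrite -opprB; apply: (submodN sD).
by have := right_part 1; rewrite !scale1r.
Qed.

Lemma critical_resolvable_rel :
  (forall A, critical Y V S A -> resolvable_rel Y P V S A) ->
  forall A, ambiguity Y V S A -> resolvable_rel Y P V S A.
Proof.
move=> crit.
have shadow_crit A : shadow_critical Y V S A -> resolvable_rel Y P V S A.
  move=> Acrit; have [/resolvable_rel_montage|Am] := pselect (montage Y V S A).
    by apply; have [] := Acrit.
  exact: crit.
move=> A Aamb.
have [/shadow_crit//|nAcrit] := pselect (shadow_critical Y V S A).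
have [B [Bmin [AB _]]] : exists B,
    shadow_minimal Y V S B /\ proper_shadow V A B.
  apply: contrapT => nB; apply: nAcrit; split=> // B Bmin AB.
  by apply: nB; exists B.
have [Bamb Bmin'] := Bmin.
apply: (resolvable_rel_shadow _ AB); first by have [] := Bamb.
by apply: shadow_crit; split=> // C [Camb _]; apply: Bmin'.
Qed.

(** * Consequences and sources of relative resolvability *)

Lemma resolvable_resolvable_rel A : ambiguity Y V S A ->
  resolvable Y V S A -> resolvable_rel Y P V S A.
Proof.
move=> [lT rT Ymu lne rne] [t [u [tT uT tu]]]; rewrite /resolvable_rel.
have lD := Tcomp_DIS Ymu tT (T1_DSM_basis lT Ymu lne).
have rD := Tcomp_DIS Ymu uT (T1_DSM_basis rT Ymu rne).
have sD := DIS_submodule (tsite A).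
rewrite -(subrKA (t (tleft A (tsite A)))); apply: (submodD sD) => //.
by rewrite -opprB tu; apply: (submodN sD).
Qed.

(** The difference [x] of the two sides lies in [DSM], and [x = x - t x] when [t x = 0], so
    [Tcomp_DIS] applies. *)
Lemma null_resolvable_rel A t : ambiguity Y V S A -> Tcomp t ->
  t (tleft A (tsite A) - tright A (tsite A)) = 0 -> resolvable_rel Y P V S A.
Proof.
move=> [lT rT Ymu lne rne] tT t0; rewrite /resolvable_rel -[_ - _]subr0 -t0.
apply: Tcomp_DIS => //; apply: (submodB (DSM_submodule _)).
all: exact: T1_DSM_basis.
Qed.

Lemma ambiguity_IS A : ambiguity Y V S A ->
  IS (tleft A (tsite A) - tright A (tsite A)).
Proof.
move=> [lT rT _ _ _]; set mu := tsite A.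
rewrite -(subrKA mu); apply: (submodD IS_submodule).
  by rewrite -opprB; apply: (submodN IS_submodule); exact/IS_sub/Tcomp_T1.
exact/IS_sub/Tcomp_T1.
Qed.

(** * Leading monomials, normal forms and Groebner bases *)

(** The hypothesis [1 <> 0] puts [s.1] into the support; over the zero ring all supports are
    empty. *)
Lemma is_lm_rule s lam : (1 : R) <> 0 -> S s ->
  is_lm Y P (s.1 - s.2) lam <-> lam = s.1.
Proof.
have [Vid _ _ _ _] := Vmonoid; move=> nz Ss.
suff LME : LM Y P (s.1 - s.2) = [set s.1].
  rewrite /is_lm LME; split=> [/(congr1 (fun A => A s.1)) /= e| ->//].
  by have : s.1 = s.1 by []; rewrite e => ->.
have c1 := rule_coef Vid Ss; have cle nu := @rule_coef_le id s nu Vid Ss.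
have Ys := rule_basis Ss.
have ssupp : supp Y (s.1 - s.2) s.1 by split=> //; rewrite c1.
apply/seteqP; split=> [nu [[Ynu nuc] numax]|_ ->] /=.
  by have [//|lt] := cle nu nuc; case: (numax _ ssupp).
split=> // nu [Ynu /cle[-> []//|lt] lt'].
by have [_ []] := ltP_trans Porder Ys Ynu Ys lt' lt.
Qed.

(** A step at [lam] changes coefficients only at or below [lam], and only if [lam] is in the
    support. Changing the one at [mu], or creating one above [mu], would put [lam] strictly above
    the maximal [mu]. *)
Lemma Tcomp_LM_irreducible t a mu : Tcomp t ->
  (forall v s, V v -> S s -> mu <> v s.1) -> LM Y P a mu -> LM Y P (t a) mu.
Proof.
move=> + irr; elim=> [//|_ u [v [s [Vv Ss ->]]] _ IH /IH {IH}] /=.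
move: (u a) => {}a [[Ymu muc] mumax]; set lam := v s.1.
have Ylam : Y lam by apply: V_basis => //; apply: rule_basis.
have cE nu : coef nu (red v s a) =
    coef nu a - coef lam a * coef nu (v (s.1 - s.2)).
  by rewrite /simple_reduction coefYB// coefYZ.
have lam_supp nu : coef lam a * coef nu (v (s.1 - s.2)) <> 0 -> supp Y a lam.
  by move=> cn0; split=> // c0; apply: cn0; rewrite c0 mul0r.
have lam_le nu : coef lam a * coef nu (v (s.1 - s.2)) <> 0 ->
    nu = lam \/ Defs.ltP P nu lam.
  move=> cn0; apply: rule_coef_le => // c0; apply: cn0; rewrite /lam.
  by rewrite c0 mulr0.
split.
  split=> //; have [->|/eqP ne] := eqVneq (coef mu (red v s a)) (coef mu a).
    by [].
  have cn0 : coef lam a * coef mu (v (s.1 - s.2)) <> 0.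
    by move=> c0; apply: ne; rewrite cE c0 subr0.
  have [mulam|lt] := lam_le _ cn0; first by case: (irr v s Vv Ss).
  by case: (mumax _ (lam_supp _ cn0)).
move=> nu [Ynu nuc] lt.
have [nua|/contrapT nua] := pselect (coef nu a <> 0).
  exact: (mumax nu (conj Ynu nua) lt).
have cn0 : coef lam a * coef nu (v (s.1 - s.2)) <> 0.
  by move=> c0; apply: nuc; rewrite cE c0 nua subr0.
apply: (mumax lam (lam_supp _ cn0)).
have [<-//|] := lam_le _ cn0; exact: (ltP_trans Porder) lt.
Qed.

Lemma unique_normal_form : (forall a, unique a) ->
  forall b, exists! a, normal_form Y V S b a.
Proof.
move=> allu b; have [t tT tI] := reduces_to_Irr b; have sI := IS_submodule.
exists (t b); split=> [|c [cI cb]].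
  by split=> //; rewrite -opprB; apply: (submodN IS_submodule); exact: IS_sub.
apply/eqP; rewrite -subr_eq0; apply/eqP/Irr_null_reducible.
  by apply: (submodB Irr_submodule).
apply: IS_null_reducible => //; rewrite -(subrKA b); apply: (submodD sI).
  by rewrite -opprB; apply: (submodN IS_submodule); exact: IS_sub.
by rewrite -opprB; apply: (submodN sI).
Qed.

(** An element of the intersection has both itself and 0 as normal forms. *)
Lemma normal_form_direct_sum : (forall b, exists! a, normal_form Y V S b a) ->
  direct_sum_decomposition Irr IS.
Proof.
move=> nf; have [sI sIrr] := (IS_submodule, Irr_submodule); split=> // [x|].
  have [a [[aI ax] _]] := nf x; exists a, (x - a); split=> //.
    by rewrite -opprB; apply: (submodN sI).
  by rewrite addrC subrK.
apply/seteqP; split=> [x [xI xS]|_ ->] /=; last first.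
  by split; [exact: submod0 sIrr|exact: submod0 sI].
have [a [_ auniq]] := nf x; rewrite -(auniq x).
  apply: auniq; split; first exact: submod0 sIrr.
  by rewrite sub0r; apply: (submodN sI).
by split; rewrite ?subrr//; exact: submod0 sI.
Qed.

Lemma direct_sum_Groebner : direct_sum_decomposition Irr IS ->
  P_monic_Groebner_basis Y P V [set s.1 - s.2 | s in S] IS.
Proof.
have sI := IS_submodule.
move=> [_ _ _ IrrIS]; split; first exact: IS_V_ideal.
- move=> _ [s Ss <-]; exists s.1; split; first exact: rule_basis.
  rewrite [s.1 - _]addrC addrK; apply: (submodN (DSM_submodule _)).
  exact: rule_DSM.
- by move=> v _ Vv [s Ss <-]; apply: IS_rule.
move=> a mu aI amu.
have [[v [s [Vv Ss muE]]]|irr] :=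
    pselect (exists v s, [/\ V v, S s & mu = v s.1]).
  exists (s.1 - s.2), v, s.1; split=> //; first by exists s.
  (* If [1 = 0], every coefficient vanishes, so [mu] could not lie in a support. *)
  apply/is_lm_rule => // nz; case: amu => -[_ []].
  by rewrite -[coef _ _]mulr1 nz mulr0.
(* The irreducible reduct of [a] lies in both summands and is 0, although [mu] would have to survive
   in its support. *)
exfalso; have [t tT tI] := reduces_to_Irr a.
have ta0 : t a = 0.
  suff : [set 0] (t a) by [].
  rewrite -IrrIS; split=> //; rewrite -(subKr a (t a)).
  apply: (submodB sI) => //.
  exact: IS_sub.
have [[_ []]] : LM Y P (t a) mu; last by rewrite ta0 coefY0.
by apply: Tcomp_LM_irreducible => // v s Vv Ss muE; apply: irr; exists v, s.
Qed.

Lemma Groebner_unique :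
  P_monic_Groebner_basis Y P V [set s.1 - s.2 | s in S] IS ->
  forall a, unique a.
Proof.
move=> [_ _ _ lead] a t u tT uT tI uI; have sI := IS_submodule.
apply/eqP; rewrite -subr_eq0; apply/eqP; set x := _ - _.
have xI : Irr x by apply: (submodB Irr_submodule).
have xS : IS x.
  rewrite /x -(subrKA a); apply: (submodD sI); last exact: IS_sub.
  by rewrite -opprB; apply: (submodN IS_submodule); exact: IS_sub.
have [s [Ys s0 xE]] := coef_decomposition Ybasis x.
(* [s'] lists the support of [x]. If nonempty, it has a maximal element, which must be some [v r.1]
   by the Groebner condition, where irreducibility forces coefficient 0. *)
pose s' := [seq y <- s | coef y x != 0].
have s'E y : y \in s' -> supp Y x y.
  by rewrite mem_filter => /andP[/eqP yx /Ys].
have s'in y : coef y x <> 0 -> y \in s'.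
  move=> yx; rewrite mem_filter; apply/andP; split; first exact/eqP.
  by apply/negPn/negP => /s0.
have [s'0|s'n0] := eqVneq s' [::].
  rewrite xE big_seq big1// => y _; have [->|/eqP/s'in] := eqVneq (coef y x) 0.
    by rewrite scale0r.
  by rewrite s'0.
have [|mu mus mumax] := maximal_exists Porder _ (elimN eqP s'n0).
  by move=> y /s'E[].
have xmu : LM Y P x mu by split; [exact: s'E|move=> y [_ /s'in]; exact: mumax].
have [_ [v [lam [[r Sr <-] Vv lamE muE]]]] := lead _ _ xS xmu.
have [[_ muc] _] := xmu.
have nz : (1 : R) <> 0.
  by move=> z; apply: muc; rewrite -[coef _ _]mulr1 z mulr0.
have /(is_lm_rule _ nz Sr) lamr := lamE.
by case: muc; rewrite muE lamr; apply: (Irr_coefP x).1.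
Qed.

Lemma unique_resolvable A : (forall a, unique a) -> ambiguity Y V S A ->
  resolvable Y V S A.
Proof.
move=> allu [lT rT _ _ _].
have [t tT tI] := reduces_to_Irr (tleft A (tsite A)).
have [u uT uI] := reduces_to_Irr (tright A (tsite A)).
exists t, u; split=> //.
apply: (allu (tsite A) (t \o tleft A) (u \o tright A)) => //.
all: exact/Tcomp_comp/Tcomp_T1.
Qed.

End Reduction.

Theorem theorem8p4 (R : pzRingType) (M : lmodType R) (Y : set M)
    (P : M -> M -> Prop) (V : set (M -> M)) (S : set (M * M))
    (Ybasis : is_basis Y)
    (Porder : partial_order_on Y P) (Pwf : well_founded_on Y P)
    (Vmonoid : monotone_hom_monoid Y P V)
    (Ssub : forall mu a, S (mu, a) -> Y mu /\ DSM Y P mu a) :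
  [<-> (* (a) *)
       forall A, ambiguity Y V S A -> resolvable Y V S A;
       (* (a') *)
       forall A, ambiguity Y V S A -> resolvable_rel Y P V S A;
       (* (a'') *)
       forall A, critical Y V S A -> resolvable_rel Y P V S A;
       (* (a''') *)
       forall A, critical Y V S A -> exists2 t, Tcomp Y V S t &
         t (tleft A (tsite A) - tright A (tsite A)) = 0;
       (* (b) *)
       forall a : M,
         persistently_reducible Y V S a /\ uniquely_reducible Y V S a;
       (* (c) *)
       forall b : M, exists! a, normal_form Y V S b a;
       (* (c), direct sum form *)
       direct_sum_decomposition (Irr Y V S) (IS Y V S);
       (* (d) *)
       P_monic_Groebner_basis Y P V [set s.1 - s.2 | s in S] (IS Y V S)].
Proof.
have all_unique := resolvable_rel_unique Ybasis Pwf Vmonoid Ssub.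
have from_critical := critical_resolvable_rel Ybasis Porder Vmonoid Ssub.
tfae.
- move=> res A Aamb; have Ares := res A Aamb.
  exact (resolvable_resolvable_rel Ybasis Porder Vmonoid Ssub Aamb Ares).
- by move=> rel A [[Aamb _] _]; apply: rel.
(* Critical resolvability already gives unique reducibility everywhere. The difference lies in [IS],
   hence in [null_reducible], whose second component is the required reduction. *)
- move=> /from_critical/all_unique allu A [[Aamb _] _].
  have AIS := ambiguity_IS Ybasis Aamb.
  exact: (IS_null_reducible Ybasis Pwf Vmonoid Ssub allu AIS).2.
- move=> crit a; split; first exact: (all_persistent Ybasis Pwf Vmonoid Ssub).
  apply: all_unique; apply: from_critical => A Acrit.
  have [[Aamb _] _] := Acrit; have [t tT t0] := crit A Acrit.
  exact (null_resolvable_rel Ybasis Porder Vmonoid Ssub Aamb tT t0).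
- move=> red.
  apply: (unique_normal_form Ybasis Pwf Vmonoid Ssub) => a.
  exact: (red a).2.
- exact: (normal_form_direct_sum Ybasis).
- exact: (direct_sum_Groebner Ybasis Porder Pwf Vmonoid Ssub).
- move=> /(Groebner_unique Ybasis Porder Vmonoid Ssub) allu A.
  exact: (unique_resolvable Ybasis Pwf Vmonoid Ssub allu).
Qed.
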